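(* Let $\lambda\in\mathbb{H}$ and let $h(x)=\sum_{n=0}^{+\infty}x^na_n\in\mathcal{SR}(\mathbb{H})$ be an entire slice-regular function ($a_n\in\mathbb{H}$). If $\lambda\neq0$, assume that there exist a positive real constant $C$ and an integer $d\in\mathbb{N}$ such that $n!\,|a_n|\leq C(n+1)^d|\lambda|^n$ for every $n\in\mathbb{N}$. Then the series $$\mathcal{E}_\lambda(h):=\sum_{n=1}^{+\infty}\frac{x^n}{n!}\sum_{k=0}^{n-1}k!\,a_k\lambda^{n-k-1}$$ converges uniformly on the compact sets of $\mathbb{H}$ to an entire slice-regular function such that $\mathcal{D}_\lambda(\mathcal{E}_\lambda(h))=h$. As a consequence, $\mathcal{D}_\lambda(g\cdot\mathcal{E}_\lambda(h))=g\cdot h$ for every slice-constant function $g$ on an axially symmetric domain $\Omega$ in $\mathbb{H}$.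
   Context: $\mathbb{H}$ is the skew field of quaternions, $\mathbb{S}=\{J\in\mathbb{H}: J^2=-1\}$, $\mathbb{N}$ includes $0$; the convention $\lambda^0=1$ is used for every $\lambda\in\mathbb{H}$ (including $\lambda=0$). For an open set $D\subseteq\mathbb{C}$ invariant under complex conjugation, put $\Omega_D=\{\alpha+J\beta:\ \alpha+i\beta\in D,\ J\in\mathbb{S}\}\subseteq\mathbb{H}$. An axially symmetric domain is a connected open set $\Omega=\Omega_D$ of this form. A stem function on $D$ is a map $F=F_1+\imath F_2:D\to\mathbb{H}\otimes_{\mathbb{R}}\mathbb{C}$ ($F_1,F_2$ $\mathbb{H}$-valued, $\imath$ the central imaginary unit of the factor $\mathbb{C}$) with $F(\overline z)=\overline{F(z)}$, conjugation acting on the factor $\mathbb{C}$. It induces the slice function $f=\mathcal{I}(F):\Omega_D\to\mathbb{H}$, $f(\alpha+J\beta)=F_1(\alpha+i\beta)+JF_2(\alpha+i\beta)$. For $F$ of class $C^1$, the slice derivative is $\frac{\partial f}{\partial x}=\mathcal{I}(\frac{\partial F}{\partial z})$ with $\frac{\partial}{\partial z}=\frac12(\partial_\alpha-\imath\partial_\beta)$. $f$ is slice-regular if $F$ is holomorphic, i.e. $\frac12(\partial_\alpha+\imath\partial_\beta)F=0$; $\mathcal{SR}(\Omega)$ is the set of slice-regular functions; entire means $\Omega=\mathbb{H}$. A slice-constant function is a slice-regular $g$ with $\frac{\partial g}{\partial x}=0$. The slice product of $f=\mathcal{I}(F)$, $g=\mathcal{I}(G)$ is $f\cdot g=\mathcal{I}(FG)$,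 with $FG$ the pointwise product in $\mathbb{H}\otimes\mathbb{C}$. For $\lambda\in\mathbb{H}$, $\mathcal{D}_\lambda f=\frac{\partial f}{\partial x}-f\lambda$ (pointwise right multiplication by $\lambda$). *)

(* Defs.v *)
From HB Require Import structures.
From mathcomp Require Import all_boot all_order all_algebra.
From mathcomp Require Import ring lra.
From mathcomp Require Import all_classical all_reals all_analysis.

Set Implicit Arguments.
Unset Strict Implicit.
Unset Printing Implicit Defensive.

Import Order.TTheory GRing.Theory Num.Theory.
Import numFieldNormedType.Exports.

Local Open Scope classical_set_scope.
Local Open Scope ring_scope.

(* [Quat a b c d] is a + b i + c j + d k. *)
Record quat (R : Type) := Quat { q0 : R ; q1 : R ; q2 : R ; q3 : R }.

Definition tuple_of_quat (R : Type) (x : quat R) :=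
  (q0 x, q1 x, q2 x, q3 x).

Definition quat_of_tuple (R : Type) (t : R * R * R * R) :=
  Quat t.1.1.1 t.1.1.2 t.1.2 t.2.

Lemma tuple_of_quatK (R : Type) :
  cancel (@tuple_of_quat R) (@quat_of_tuple R).
Proof. by case. Qed.

HB.instance Definition _ (R : choiceType) :=
  Choice.copy (quat R) (can_type (@tuple_of_quatK R)).

Section QuaternionAlgebra.
Variable R : comNzRingType.
Implicit Types (s t : R) (x y z : quat R).

Definition addH x y :=
  Quat (q0 x + q0 y) (q1 x + q1 y) (q2 x + q2 y) (q3 x + q3 y).

Definition oppH x := Quat (- q0 x) (- q1 x) (- q2 x) (- q3 x).

Definition scaleH s x := Quat (s * q0 x) (s * q1 x) (s * q2 x) (s * q3 x).

Definition mulH x y := Quat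
  (q0 x * q0 y - q1 x * q1 y - q2 x * q2 y - q3 x * q3 y)
  (q0 x * q1 y + q1 x * q0 y + q2 x * q3 y - q3 x * q2 y)
  (q0 x * q2 y - q1 x * q3 y + q2 x * q0 y + q3 x * q1 y)
  (q0 x * q3 y + q1 x * q2 y - q2 x * q1 y + q3 x * q0 y).

Lemma eq_quat x y :
  q0 x = q0 y -> q1 x = q1 y -> q2 x = q2 y -> q3 x = q3 y -> x = y.
Proof. by case: x y => ? ? ? ? [? ? ? ?] /= -> -> -> ->. Qed.

Lemma addHA : associative addH.
Proof. by move=> x y z; apply: eq_quat => /=; ring. Qed.

Lemma addHC : commutative addH.
Proof. by move=> x y; apply: eq_quat => /=; ring. Qed.

Lemma add0H : left_id (Quat 0 0 0 0) addH.
Proof. by move=> x; apply: eq_quat => /=; ring. Qed.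

Lemma addNH : left_inverse (Quat 0 0 0 0) oppH addH.
Proof. by move=> x; apply: eq_quat => /=; ring. Qed.

HB.instance Definition _ :=
  GRing.isZmodule.Build (quat R) addHA addHC add0H addNH.

Lemma mulHA : associative mulH.
Proof. by move=> x y z; apply: eq_quat => /=; ring. Qed.

Lemma mul1H : left_id (Quat 1 0 0 0) mulH.
Proof. by move=> x; apply: eq_quat => /=; ring. Qed.

Lemma mulH1 : right_id (Quat 1 0 0 0) mulH.
Proof. by move=> x; apply: eq_quat => /=; ring. Qed.

Lemma mulHDl : left_distributive mulH +%R.
Proof. by move=> x y z; apply: eq_quat => /=; ring. Qed.

Lemma mulHDr : right_distributive mulH +%R.
Proof. by move=> x y z; apply: eq_quat => /=; ring. Qed.

Lemma oneH_neq0 : Quat 1 0 0 0 != 0 :> quat R.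
Proof. by apply/eqP => -[/eqP]; rewrite oner_eq0. Qed.

HB.instance Definition _ := GRing.Zmodule_isNzRing.Build (quat R)
  mulHA mul1H mulH1 mulHDl mulHDr oneH_neq0.

Lemma scaleHA s t x : scaleH s (scaleH t x) = scaleH (s * t) x.
Proof. by apply: eq_quat => /=; ring. Qed.

Lemma scale1H : left_id 1 scaleH.
Proof. by move=> x; apply: eq_quat => /=; ring. Qed.

Lemma scaleHDr : right_distributive scaleH +%R.
Proof. by move=> s x y; apply: eq_quat => /=; ring. Qed.

Lemma scaleHDl x : {morph scaleH^~ x : s t / s + t}.
Proof. by move=> s t; apply: eq_quat => /=; ring. Qed.

HB.instance Definition _ := GRing.Zmodule_isLmodule.Build R (quat R)
  scaleHA scale1H scaleHDr scaleHDl.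

Lemma scaleHAl s x y : s *: (x * y) = (s *: x) * y.
Proof. by apply: eq_quat => /=; ring. Qed.

Lemma scaleHAr s x y : s *: (x * y) = x * (s *: y).
Proof. by apply: eq_quat => /=; ring. Qed.

HB.instance Definition _ := GRing.Lmodule_isLalgebra.Build R (quat R) scaleHAl.
HB.instance Definition _ := GRing.Lalgebra_isAlgebra.Build R (quat R) scaleHAr.

Definition qi : quat R := Quat 0 1 0 0.

Definition qim x : quat R := Quat 0 (q1 x) (q2 x) (q3 x).

End QuaternionAlgebra.

Section QuaternionNorm.
Variable R : realType.
Implicit Types (s : R) (x y z : quat R).

Definition sqnormH x := q0 x ^+ 2 + q1 x ^+ 2 + q2 x ^+ 2 + q3 x ^+ 2.

Definition normH x : R := Num.sqrt (sqnormH x).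

Lemma sqnormH_ge0 x : 0 <= sqnormH x.
Proof. by rewrite !addr_ge0 ?sqr_ge0. Qed.

Lemma normH_ge0 x : 0 <= normH x. Proof. exact: sqrtr_ge0. Qed.

Lemma sqr_normH x : normH x ^+ 2 = sqnormH x.
Proof. by rewrite sqr_sqrtr ?sqnormH_ge0. Qed.

Lemma normHD x y : normH (x + y) <= normH x + normH y.
Proof.
have CS : q0 x * q0 y + q1 x * q1 y + q2 x * q2 y + q3 x * q3 y
          <= normH x * normH y.
  set p := (X in X <= _); have [p0|/ltW p0] := leP p 0.
    by rewrite (le_trans p0) ?mulr_ge0 ?normH_ge0.
  rewrite -(@ler_pXn2r _ 2%N) ?nnegrE ?mulr_ge0 ?normH_ge0// exprMn !sqr_normH.
  rewrite -subr_ge0 /p /sqnormH.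
  rewrite [leRHS](_ : _ =
      (q0 x * q1 y - q1 x * q0 y) ^+ 2 + (q0 x * q2 y - q2 x * q0 y) ^+ 2
    + (q0 x * q3 y - q3 x * q0 y) ^+ 2 + (q1 x * q2 y - q2 x * q1 y) ^+ 2
    + (q1 x * q3 y - q3 x * q1 y) ^+ 2 + (q2 x * q3 y - q3 x * q2 y) ^+ 2);
    last by ring.
  by rewrite !addr_ge0 ?sqr_ge0.
rewrite -(@ler_pXn2r _ 2%N) ?nnegrE ?addr_ge0 ?normH_ge0// sqrrD !sqr_normH.
rewrite /sqnormH /=; move: CS; set c := normH x * normH y; rewrite mulr2n.
lra.
Qed.

Lemma normHZ s x : normH (s *: x) = `|s| * normH x.
Proof.
rewrite /normH (_ : sqnormH (s *: x) = s ^+ 2 * sqnormH x).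
  by rewrite sqrtrM ?sqr_ge0// sqrtr_sqr.
by rewrite /sqnormH /=; ring.
Qed.

Lemma normH0_eq0 x : normH x = 0 -> x = 0.
Proof.
move=> x0; have := sqr_normH x; rewrite x0 expr0n /= /sqnormH => /esym/eqP.
rewrite !paddr_eq0 ?addr_ge0 ?sqr_ge0// !sqrf_eq0.
by move=> /andP[/andP[/andP[/eqP ? /eqP ?] /eqP ?] /eqP ?]; exact: eq_quat.
Qed.

HB.instance Definition _ := Lmodule_isNormed.Build R (quat R)
  normHD normHZ normH0_eq0.

End QuaternionNorm.

(* The complex plane is identified with R * R: alpha + i beta is
   (alpha, beta).  An element p + \imath q of H (x)_R C is the pair (p, q). *)
Notation HC R := (quat R * quat R)%type.

Section SliceFunctions.
Variable R : realType.
Implicit Types (z : R * R) (w : HC R) (D : set (R * R)) (F G : R * R -> HC R).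
Implicit Types (x J lambda : quat R) (f g : quat R -> quat R).

Definition conjC2 z : R * R := (z.1, - z.2).

Definition conjHC w : HC R := (w.1, - w.2).

Definition mulHC w1 w2 : HC R :=
  (w1.1 * w2.1 - w1.2 * w2.2, w1.1 * w2.2 + w1.2 * w2.1).

(* Multiplication by the central imaginary unit \imath. *)
Definition imulHC w : HC R := (- w.2, w.1).

Definition imag_unit : set (quat R) := [set J | J ^+ 2 = -1].

Definition Omega D : set (quat R) :=
  [set x | exists z J, [/\ D z, imag_unit J & x = z.1%:A + z.2 *: J]].

Definition symmetric_open D := open D /\ (forall z, D z -> D (conjC2 z)).

Definition axially_symmetric_domain D :=
  [/\ symmetric_open D, open (Omega D) & connected (Omega D)].

Definition stem D F := forall z, D z -> F (conjC2 z) = conjHC (F z).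

(* Canonical choice of J in x = alpha + J beta, with beta = |Im x| >= 0; for
   real x the choice is irrelevant when F is a stem function. *)
Definition dir x : quat R :=
  if qim x == 0 then qi R else `|qim x|^-1 *: qim x.

Definition slice_fun F x : quat R :=
  (F (q0 x, `|qim x|)).1 + dir x * (F (q0 x, `|qim x|)).2.

Definition dalpha F z : HC R := derive1 (fun t : R => F (t, z.2)) z.1.

Definition dbeta F z : HC R := derive1 (fun t : R => F (z.1, t)) z.2.

Definition C1_on D F := forall z, D z ->
  [/\ derivable (fun t : R => F (t, z.2)) z.1 1,
      derivable (fun t : R => F (z.1, t)) z.2 1,
      {for z, continuous (dalpha F)} & {for z, continuous (dbeta F)}].

Definition dz F z : HC R := 2^-1 *: (dalpha F z - imulHC (dbeta F z)).

Definition dzbar F z : HC R := 2^-1 *: (dalpha F z + imulHC (dbeta F z)).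

(* Slice functions are total on [quat R], but only their values on [Omega D]
   are meaningful; likewise for stem functions and D. *)
Definition induces D F f :=
  stem D F /\ (forall x, Omega D x -> f x = slice_fun F x).

(* The stem function inducing f, which is unique on D (see [stem_ofE]). *)
Definition stem_of D f : R * R -> HC R := xget (fun=> 0) (induces D ^~ f).

Definition slice_C1 D f := exists F, induces D F f /\ C1_on D F.

Definition slice_regular D f := exists F,
  [/\ induces D F f, C1_on D F & forall z, D z -> dzbar F z = 0].

Definition slice_deriv D f : quat R -> quat R := slice_fun (dz (stem_of D f)).

Definition slice_constant D g :=
  slice_regular D g /\ (forall x, Omega D x -> slice_deriv D g x = 0).

Definition slice_mul D f g : quat R -> quat R :=
  slice_fun (fun z => mulHC (stem_of D f z) (stem_of D g z)).

Definition Dlam D lambda f x : quat R := slice_deriv D f x - f x * lambda.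

(* N-th partial sum (1 <= n <= N) of the series defining E_lambda(h). *)
Definition Elam_psum lambda (a : nat -> quat R) (N : nat) x : quat R :=
  \sum_(1 <= n < N.+1) (n`!%:R^-1 *: x ^+ n) *
    \sum_(0 <= k < n) (k`!%:R *: a k) * lambda ^+ (n - k - 1).

Definition Elam lambda (a : nat -> quat R) x : quat R :=
  lim ((Elam_psum lambda a ^~ x) @ \oo).

Lemma imag_unitP J : imag_unit J -> q0 J = 0 /\ `|J| = 1.
Proof.
move=> JJ; have J0 : q0 J = 0.
  apply/eqP/negPn/negP => J0.
  move: JJ; rewrite /imag_unit /= expr2 => -[] e0 e1 e2 e3.
  have z1 : q1 J = 0 by apply: (mulfI J0); move: e1; rewrite mulr0; lra.
  have z2 : q2 J = 0 by apply: (mulfI J0); move: e2; rewrite mulr0; lra.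
  have z3 : q3 J = 0 by apply: (mulfI J0); move: e3; rewrite mulr0; lra.
  by move: e0; rewrite z1 z2 z3; nra.
split=> //; move: JJ; rewrite /imag_unit /= expr2 => -[] e0 _ _ _.
rewrite [LHS](_ : _ = Num.sqrt (sqnormH J))// (_ : sqnormH J = 1) ?sqrtr1//.
by rewrite /sqnormH; move: e0; rewrite J0; lra.
Qed.

Lemma slice_funE D F z J : stem D F -> D z -> imag_unit J ->
  slice_fun F (z.1%:A + z.2 *: J) = (F z).1 + J * (F z).2.
Proof.
move=> sF Dz /imag_unitP[J0 J1]; case: z Dz => al be /= Dz.
set x := _ + _.
have x0 : q0 x = al by rewrite /x /= J0; ring.
have xim : qim x = be *: J by apply: eq_quat => /=; rewrite ?J0; ring.
rewrite /slice_fun /dir x0 xim normrZ J1 mulr1 scaler_eq0.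
have -> : (J == 0) = false by apply/negbTE; rewrite -normr_eq0 J1 oner_eq0.
rewrite orbF; have sFz := sF _ Dz; have [be0|be0] := eqVneq be 0.
  move: sFz; rewrite be0 /conjC2 /= oppr0 normr0 => -[/=].
  case: (F (al, 0)) => u v /= [] /eqP; rewrite -addr_eq0 -mulr2n -scaler_nat.
  by rewrite scaler_eq0 pnatr_eq0 /= => /eqP ->; rewrite !mulr0.
have [b0|b0] := lerP 0 be.
  by rewrite (ger0_norm b0) scalerA mulVf// scale1r.
rewrite (ltr0_norm b0) scalerA invrN mulNr mulVf// scaleN1r.
by move: sFz; rewrite /conjC2 /= => ->; rewrite /= mulrNN.
Qed.

Lemma stem_ofE D F f z : (forall z, D z -> D (conjC2 z)) ->
  induces D F f -> D z -> stem_of D f z = F z.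
Proof.
move=> sD iF Dz; have [sG fG] : induces D (stem_of D f) f.
  by apply: (@xgetPex _ (fun=> 0) (induces D ^~ f)); exists F.
case: iF => sF fF.
have qi2 : imag_unit (qi R) by apply: eq_quat; rewrite /= ?expr2 /=; ring.
have qiN2 : imag_unit (- qi R) by apply: eq_quat; rewrite /= ?expr2 /=; ring.
have E J : imag_unit J ->
    (stem_of D f z).1 + J * (stem_of D f z).2 = (F z).1 + J * (F z).2.
  move=> JJ; rewrite -(slice_funE sG Dz JJ) -(slice_funE sF Dz JJ).
  by rewrite -fG ?fF//; exists z, J.
move: (E _ qi2) (E _ qiN2); move: (stem_of D f z) (F z) => [p q] [r s] /=.
move=> [] e0 e1 e2 e3 [] e0' e1' e2' e3'.
by congr pair; apply: eq_quat; lra.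
Qed.

Lemma Omega_setT : Omega setT = setT.
Proof.
apply/seteqP; split=> // x _; exists (q0 x, `|qim x|), (dir x); split=> //.
  rewrite /dir; case: ifPn => [_|x0].
    by apply: eq_quat; rewrite /= ?expr2 /=; ring.
  have N0 : `|qim x| != 0 by rewrite normr_eq0.
  have NE : `|qim x| ^+ 2 = sqnormH (qim x) by exact: sqr_normH.
  rewrite /imag_unit /= exprZn; apply: (scalerI (expf_neq0 2 N0)).
  rewrite scalerA exprVn mulfV ?expf_neq0// scale1r NE /sqnormH.
  by apply: eq_quat; rewrite /= ?expr2 /=; ring.
rewrite /dir; case: ifPn => [/eqP x0|x0].
  rewrite x0 normr0 scale0r addr0; case: x0 => e1 e2 e3.
  by apply: eq_quat => /=; rewrite ?e1 ?e2 ?e3; ring.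
rewrite /= scalerA mulfV ?normr_eq0// scale1r.
by apply: eq_quat => /=; ring.
Qed.

End SliceFunctions.

(* Main.v *)
(* With e_n the coefficients of E_lambda(h), one has
   (n+1) e_{n+1} - e_n lambda = a_n, so formally D_lambda(E_lambda(h)) = h.  The
   growth hypothesis bounds |e_n| by C s^n / n!, hence |e_n| r^n is bounded for
   every r, and comparison with geometric series gives all the convergence that
   is needed.  The stem function of sum x^n e_n is the series of z^n e_n in
   H (x) C; Taylor bounds for z^n, summed over n, show that its partial
   derivatives are S and \imath S, with S the series of (n+1) e_{n+1}.  Finally,
   the stem function G of a slice-constant g has dG/dz = dG/dzbar = 0, so it is
   locally constant, and G acts as a constant factor in D_lambda. *)

Require Import Defs.
From mathcomp Require Import all_boot all_order all_algebra.
From mathcomp Require Import ring lra zify.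
From mathcomp Require Import all_classical all_reals all_analysis.

Set Implicit Arguments.
Unset Strict Implicit.
Unset Printing Implicit Defensive.

Import Order.TTheory GRing.Theory Num.Theory.
Import numFieldNormedType.Exports.
Local Open Scope classical_set_scope.
Local Open Scope ring_scope.

(** * Multiplicativity of the quaternion norm and geometric domination of series *)

Section Series.
Variable R : realType.

Lemma quat_normM (x y : quat R) : `|x * y| = `|x| * `|y|.
Proof.
rewrite -[LHS]/(Num.sqrt (sqnormH (x * y))) -[`|x|]/(Num.sqrt (sqnormH x)).
rewrite -[`|y|]/(Num.sqrt (sqnormH y)) -sqrtrM ?sqnormH_ge0//; congr Num.sqrt.
by rewrite /sqnormH /=; ring.
Qed.

Lemma quat_normr1 : `|1 : quat R| = 1.
Proof.
rewrite -[LHS]/(Num.sqrt (sqnormH 1)) /sqnormH /=.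
by rewrite expr1n !expr0n /= !addr0 sqrtr1.
Qed.

Lemma quat_normX (x : quat R) n : `|x ^+ n| = `|x| ^+ n.
Proof.
by elim: n => [|n IHn]; rewrite ?expr0 ?quat_normr1// !exprS quat_normM IHn.
Qed.

Lemma quat_basisE (x : quat R) :
  x = q0 x *: 1 + q1 x *: Quat 0 1 0 0 + q2 x *: Quat 0 0 1 0
      + q3 x *: Quat 0 0 0 1.
Proof. by apply: eq_quat => /=; ring. Qed.

Lemma coord_le_norm (x : quat R) :
  [/\ `|q0 x| <= `|x|, `|q1 x| <= `|x|, `|q2 x| <= `|x| & `|q3 x| <= `|x|].
Proof.
rewrite -[`|x|]/(Num.sqrt (sqnormH x)) -!sqrtr_sqr.
by split; rewrite ler_wsqrtr// /sqnormH; rewrite -subr_ge0;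
  have := (sqr_ge0 (q0 x), sqr_ge0 (q1 x), sqr_ge0 (q2 x), sqr_ge0 (q3 x));
  move=> [[[]]]; lra.
Qed.

Lemma is_cvg_geometric_le (u : R ^nat) (B : R) :
  (forall n, `|u n| <= B * 2^-1 ^+ n) -> cvgn (series u).
Proof.
move=> uB; apply: normed_cvg; apply: (@series_le_cvg _ _ (geometric B 2^-1)).
- by move=> n /=.
- by move=> n /=; exact: le_trans (uB n).
- exact: uB.
- apply: is_cvg_geometric_series.
  by rewrite ger0_norm ?invr_ge0// invf_lt1 ?ltr1n.
Qed.

(** The norm dominates each real coordinate, so the scalar comparison applies to the four coordinate
    series; their limits are reassembled in the basis 1, i, j, k. *)
Lemma quat_is_cvg_geometric_le (u : nat -> quat R) (B : R) :
  (forall n, `|u n| <= B * 2^-1 ^+ n) -> cvgn (series u).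
Proof.
move=> uB.
have cq (q : quat R -> R) : {morph q : x y / x + y} -> q 0 = 0 ->
    (forall x, `|q x| <= `|x|) -> cvgn (q \o series u).
  move=> qD q00 qx; rewrite (_ : q \o _ = series (q \o u)).
    by apply: is_cvg_geometric_le => n; exact: le_trans (qx _) (uB n).
  by apply/funext => n; rewrite /series /= (big_morph q qD q00).
rewrite (_ : series u = fun n => q0 (series u n) *: 1
    + q1 (series u n) *: Quat 0 1 0 0 + q2 (series u n) *: Quat 0 0 1 0
    + q3 (series u n) *: Quat 0 0 0 1); last first.
  by apply/funext => n; exact: quat_basisE.
by do !apply: is_cvgD; apply: is_cvgZr_tmp; apply: cq => // x;
  case: (coord_le_norm x).
Qed.

(** The explicit rate serves twice: it gives uniform convergence, and at N = 0 it bounds the norm of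
    the limit, which is how termwise estimates are summed. *)
Lemma series_geometric_tail (V : normedModType R) (u : nat -> V) (l : V)
    (B : R) (N : nat) :
  (forall n, `|u n| <= B * 2^-1 ^+ n) -> series u @ \oo --> l ->
  `|l - series u N| <= 2 * B * 2^-1 ^+ N.
Proof.
move=> uB ul.
have B0 : 0 <= B by have := uB 0; rewrite expr0 mulr1; exact: le_trans.
have part m :
    `|series u (N + m)%N - series u N| <= 2 * B * (2^-1 ^+ N - 2^-1 ^+ (N + m)).
  elim: m => [|m IHm]; first by rewrite addn0 !subrr normr0 mulr0.
  rewrite addnS seriesSr addrAC (le_trans (ler_normD _ _))//.
  rewrite (le_trans (lerD IHm (uB _)))// exprS; lra.
have cv : `|series u (N + m)%N - series u N| @[m --> \oo] --> `|l - series u N|.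
  apply: cvg_norm; apply: cvgB; last exact: cvg_cst.
  by rewrite (_ : (fun m => _) = (fun m => series u (m + N)%N)) ?cvg_shiftn//;
    apply/funext => m; rewrite addnC.
apply: (ler_cvg_to cv (cvg_cst _)); near=> m; apply: (le_trans (part m)).
by rewrite ler_wpM2l ?mulr_ge0// gerBl exprn_ge0// invr_ge0.
Unshelve. all: by end_near. Qed.

End Series.

(** * Powers in the complex plane and their first-order Taylor bounds *)

Section PlaneArithmetic.
Variable R : realType.
Implicit Types (z w p : R * R) (M : R) (n : nat).

(* R * R with [cmul] is the complex plane; [csize] is a submultiplicative norm. *)
Definition cmul z w : R * R := (z.1 * w.1 - z.2 * w.2, z.1 * w.2 + z.2 * w.1).

Fixpoint cpow z n : R * R := if n is m.+1 then cmul z (cpow z m) else (1, 0).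

(** At n = 0 the zero scalar cancels the value produced by the truncated predecessor. *)
Definition dcpow z n : R * R := n%:R *: cpow z n.-1.

Definition csize z : R := `|z.1| + `|z.2|.

Lemma csize_ge0 z : 0 <= csize z. Proof. by rewrite addr_ge0. Qed.

Lemma csizeD z w : csize (z + w) <= csize z + csize w.
Proof.
by rewrite /csize /= addrACA lerD// ler_normD.
Qed.

Lemma csizeM z w : csize (cmul z w) <= csize z * csize w.
Proof.
rewrite /csize /cmul /= (le_trans (lerD (ler_normB _ _) (ler_normD _ _)))//.
by rewrite !normrM mulrDl !mulrDr; lra.
Qed.

Lemma csize_cpow z n M : csize z <= M -> csize (cpow z n) <= M ^+ n.
Proof.
move=> zM; elim: n => [|n IHn].
  by rewrite expr0 /csize /= normr1 normr0 addr0.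
by rewrite exprS (le_trans (csizeM _ _))// ler_pM ?csize_ge0.
Qed.

(** Induction on (z+w)^(n+1) - z^(n+1) = (z+w)((z+w)^n - z^n) + w z^n. As M >= 1, the exponent n - 1
    is relaxed to n, which avoids a special case at 0. *)
Lemma cpow_lipschitz z w n M : 1 <= M -> csize z <= M -> csize (z + w) <= M ->
  csize (cpow (z + w) n - cpow z n) <= n%:R * csize w * M ^+ n.
Proof.
move=> M1 zM zwM; elim: n => [|n IHn].
  by rewrite subrr /csize /= normr0 !mul0r addr0.
have -> : cpow (z + w) n.+1 - cpow z n.+1 =
    cmul (z + w) (cpow (z + w) n - cpow z n) + cmul w (cpow z n).
  by congr pair => /=; ring.
rewrite (le_trans (csizeD _ _))//.
have h1 : csize (cmul (z + w) (cpow (z + w) n - cpow z n)) <=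
    M * (n%:R * csize w * M ^+ n).
  by rewrite (le_trans (csizeM _ _))// ler_pM ?csize_ge0.
have h2 : csize (cmul w (cpow z n)) <= csize w * (M * M ^+ n).
  rewrite (le_trans (csizeM _ _))// ler_wpM2l ?csize_ge0//.
  rewrite (le_trans (csize_cpow n zM))// ler_peMl// exprn_ge0//.
  exact: le_trans ler01 M1.
by rewrite (le_trans (lerD h1 h2))// exprS -natr1; lra.
Qed.

(** The remainder satisfies r_(n+1) = z r_n + w((z+w)^n - z^n); the Lipschitz bound controls the
    second term, and n^2 + n <= (n+1)^2 closes the induction. The factor n^2 is not sharp, but
    entire coefficients absorb polynomial factors. *)
Lemma cpow_taylor z w n M : 1 <= M -> csize z <= M -> csize (z + w) <= M ->
  csize (cpow (z + w) n - cpow z n - cmul w (dcpow z n))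
    <= n%:R ^+ 2 * csize w ^+ 2 * M ^+ n.
Proof.
move=> M1 zM zwM; elim: n => [|n IHn].
  have -> : cpow (z + w) 0 - cpow z 0 - cmul w (dcpow z 0) = 0.
    by rewrite /dcpow scale0r; congr pair => /=; ring.
  by rewrite /csize /= normr0 addr0 expr0n /= !mul0r.
have dS : dcpow z n.+1 = cpow z n + cmul z (dcpow z n).
  rewrite /dcpow; case: n {IHn} => [|n] /=.
    by rewrite scale1r scale0r; congr pair => /=; ring.
  by rewrite -[n.+2%:R]natr1; congr pair => /=; rewrite /GRing.scale /=; ring.
have -> : cpow (z + w) n.+1 - cpow z n.+1 - cmul w (dcpow z n.+1) =
    cmul z (cpow (z + w) n - cpow z n - cmul w (dcpow z n))
    + cmul w (cpow (z + w) n - cpow z n).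
  by rewrite dS; congr pair => /=; ring.
rewrite (le_trans (csizeD _ _))//.
have h1 : csize (cmul z (cpow (z + w) n - cpow z n - cmul w (dcpow z n))) <=
    M * (n%:R ^+ 2 * csize w ^+ 2 * M ^+ n).
  by rewrite (le_trans (csizeM _ _))// ler_pM ?csize_ge0.
have h2 : csize (cmul w (cpow (z + w) n - cpow z n)) <=
    csize w * (M * (n%:R * csize w * M ^+ n)).
  rewrite (le_trans (csizeM _ _))// ler_wpM2l ?csize_ge0//.
  rewrite (le_trans (cpow_lipschitz n M1 zM zwM))// ler_peMl//.
  by rewrite !mulr_ge0 ?csize_ge0 ?exprn_ge0 ?ler0n// (le_trans ler01 M1).
rewrite (le_trans (lerD h1 h2))// [M ^+ n.+1]exprS -natr1 -subr_ge0.
have -> : (n%:R + 1) ^+ 2 * csize w ^+ 2 * (M * M ^+ n)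
    - (M * (n%:R ^+ 2 * csize w ^+ 2 * M ^+ n)
       + csize w * (M * (n%:R * csize w * M ^+ n)))
    = (n%:R + 1) * csize w ^+ 2 * (M * M ^+ n) by ring.
have M0 := le_trans ler01 M1.
by rewrite !mulr_ge0 ?exprn_ge0 ?csize_ge0 ?addr_ge0.
Qed.

End PlaneArithmetic.

(** * Power series over the plane with quaternion coefficients, and their partial derivatives *)

Section PowerSeries.
Variable R : realType.
Implicit Types (e : nat -> quat R) (z w p : R * R) (r M : R) (n : nat).

(** Infinite radius of convergence, expressed by boundedness: this transfers easily between
    sequences, and a larger radius turns it into geometric decay. *)
Definition entire_coef e :=
  forall r, 0 <= r -> exists B, forall n, `|e n| * r ^+ n <= B.

Definition plane_scale p (x : quat R) : HC R := (p.1 *: x, p.2 *: x).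

Definition dcoef e n : quat R := n.+1%:R *: e n.+1.

(* The stem function of the slice function sum x^n e_n. *)
Definition pser e z : HC R :=
  (limn (series (fun n => (cpow z n).1 *: e n)),
   limn (series (fun n => (cpow z n).2 *: e n))).

Lemma norm_plane_scale p x : `|plane_scale p x| <= csize p * `|x|.
Proof.
by rewrite prod_normE /= !normrZ ge_max /csize mulrDl lerDl lerDr !mulr_ge0.
Qed.

Lemma plane_scaleB p q x :
  plane_scale (p - q) x = plane_scale p x - plane_scale q x.
Proof. by congr pair; rewrite scalerBl. Qed.

Lemma plane_scaleM w p x : plane_scale (cmul w p) x =
  w.1 *: plane_scale p x + w.2 *: imulHC (plane_scale p x).
Proof.
congr pair => /=; rewrite !scalerA; last by rewrite scalerDl.
by rewrite scalerN scalerA scalerBl.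
Qed.

Lemma entire_coef_half e r : entire_coef e -> 0 <= r ->
  exists2 B, 0 <= B & forall n, `|e n| * r ^+ n <= B * 2^-1 ^+ n.
Proof.
move=> ee r0; have [|B eB] := ee (2 * r); first by rewrite mulr_ge0.
have B0 : 0 <= B by have := eB 0; rewrite expr0 mulr1; exact: le_trans.
exists B => // n; rewrite exprVn ler_pdivlMr ?exprn_gt0//.
by rewrite -mulrA -exprMn [r * 2]mulrC.
Qed.

Lemma natr_le_exp2 n : n%:R <= 2 ^+ n :> R.
Proof. by rewrite -natrX ler_nat ltnW// ltn_expl. Qed.

Lemma entire_dcoef e : entire_coef e -> entire_coef (dcoef e).
Proof.
(* In (n+1) r^n <= (2(r+1))^(n+1), the power of 2 absorbs n + 1, and r + 1 >= 1 lets the exponent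
   rise from n to n + 1. *)
move=> ee r r0; have [|B eB] := ee (2 * (r + 1)).
  by rewrite mulr_ge0// addr_ge0.
exists B => n; rewrite /dcoef normrZ normr_nat (le_trans _ (eB n.+1))//.
rewrite [_ * `|_|]mulrC -mulrA ler_wpM2l// exprMn.
rewrite ler_pM ?exprn_ge0 ?natr_le_exp2//.
rewrite (@le_trans _ _ ((r + 1) ^+ n))//.
  by rewrite lerXn2r ?nnegrE ?addr_ge0// lerDl.
by rewrite ler_weXn2l ?lerDr.
Qed.

Lemma cvg_pser e z : entire_coef e ->
  series (fun n => plane_scale (cpow z n) (e n)) @ \oo --> pser e z.
Proof.
move=> ee; have [B B0 eB] := entire_coef_half ee (csize_ge0 z).
have eB' n : `|plane_scale (cpow z n) (e n)| <= B * 2^-1 ^+ n.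
  rewrite (le_trans (norm_plane_scale _ _))// mulrC (le_trans _ (eB n))//.
  by rewrite ler_wpM2l// csize_cpow.
rewrite (_ : series _ = fun n => (series (fun n => (cpow z n).1 *: e n) n,
    series (fun n => (cpow z n).2 *: e n) n)); last first.
  by apply/funext => n; rewrite /series /= [LHS]surjective_pairing
    (big_morph fst (fun _ _ => erefl) erefl)
    (big_morph snd (fun _ _ => erefl) erefl).
apply: (@cvg_pair _ _ _ _ (nbhs _) (nbhs _));
  apply: (@quat_is_cvg_geometric_le _ _ B) => n;
  by rewrite (le_trans _ (eB' n))// prod_normE le_max lexx ?orbT.
Qed.

(** The term of index 0 vanishes, so a shift of the index turns n z^(n-1) e_n into z^n (n+1)
    e_(n+1). *)
Lemma cvg_dpser e z : entire_coef e ->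
  series (fun n => plane_scale (dcpow z n) (e n)) @ \oo --> pser (dcoef e) z.
Proof.
move=> ee; rewrite -(cvg_shiftS (series _)) /=.
rewrite (_ : (fun n => _) = series (fun n => plane_scale (cpow z n) (dcoef e n))).
  exact: cvg_pser (entire_dcoef ee).
apply/funext => N; rewrite /series /= big_nat_recl//.
rewrite {1}/plane_scale /dcpow !scale0r add0r.
by apply: eq_bigr => n _; congr pair; rewrite /= scalerA mulrC.
Qed.

Lemma imulHC_continuous : continuous (@imulHC R).
Proof.
move=> w; apply: (@cvg_pair _ _ _ _ (nbhs _) (nbhs _)); last exact: cvg_fst.
by apply: cvgN; exact: cvg_snd.
Qed.

Lemma series_plane_scaleB e (p q : nat -> R * R) :
  series (fun n => plane_scale (p n - q n) (e n)) =
  (fun N => series (fun n => plane_scale (p n) (e n)) N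
          - series (fun n => plane_scale (q n) (e n)) N).
Proof.
apply/funext => N; rewrite /series /= -sumrB.
by apply: eq_bigr => n _; exact: plane_scaleB.
Qed.

Lemma series_plane_scaleM e w (p : nat -> R * R) :
  series (fun n => plane_scale (cmul w (p n)) (e n)) =
  (fun N => w.1 *: series (fun n => plane_scale (p n) (e n)) N
          + w.2 *: imulHC (series (fun n => plane_scale (p n) (e n)) N)).
Proof.
apply/funext => N; rewrite /series /=.
have iD : {morph @imulHC R : x y / x + y}.
  by move=> x y; congr pair => /=; rewrite opprD.
have i0 : imulHC 0 = 0 :> HC R by congr pair; rewrite /= oppr0.
rewrite (big_morph _ iD i0) !scaler_sumr -big_split.
by apply: eq_bigr => n _; exact: plane_scaleM.
Qed.

(** The bounds on z^n are summed over n. The linear estimate gives continuity; the quadratic one,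
    whose linear part is multiplication by w with i acting as [imulHC], gives the partial
    derivatives. *)
Lemma pser_estimates e z : entire_coef e -> exists2 K, 0 <= K &
  forall w, csize w <= 1 ->
    `|pser e (z + w) - pser e z| <= K * csize w /\
    `|pser e (z + w) - pser e z
      - (w.1 *: pser (dcoef e) z + w.2 *: imulHC (pser (dcoef e) z))|
      <= K * csize w ^+ 2.
Proof.
move=> ee; set M := csize z + 1.
have M1 : 1 <= M by rewrite lerDr csize_ge0.
have M0 : 0 <= M by exact: le_trans ler01 M1.
(* M bounds both z and z + w. The radius 4M leaves a factor 4^n that absorbs n and n^2, besides the
   decay 2^-n. *)
have [|B B0 eB] := @entire_coef_half e (4 * M) ee; first by rewrite mulr_ge0.
exists (2 * B); first by rewrite mulr_ge0.
move=> w w1.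
have zM : csize z <= M by rewrite lerDl.
have zwM : csize (z + w) <= M by rewrite (le_trans (csizeD _ _))// lerD2l.
have bound (c s : R) (p : R * R) n : 0 <= c -> c <= 4 ^+ n -> 0 <= s ->
    csize p <= c * s * M ^+ n ->
    `|plane_scale p (e n)| <= B * s * 2^-1 ^+ n.
  move=> c0 c4 s0 pc; rewrite (le_trans (norm_plane_scale _ _))//.
  rewrite (le_trans (ler_wpM2r (normr_ge0 _) pc))//.
  have -> : c * s * M ^+ n * `|e n| = s * (`|e n| * (c * M ^+ n)) by ring.
  rewrite [leRHS](_ : _ = s * (B * 2^-1 ^+ n)); last by ring.
  rewrite ler_wpM2l// (le_trans _ (eB n))// ler_wpM2l//.
  by rewrite exprMn ler_wpM2r// exprn_ge0.
have cl : series (fun n => plane_scale (cpow (z + w) n - cpow z n) (e n)) @ \oo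
    --> pser e (z + w) - pser e z.
  by rewrite series_plane_scaleB; apply: cvgB; exact: cvg_pser.
have tail0 (u : nat -> HC R) (l : HC R) (s : R) :
    (forall n, `|u n| <= B * s * 2^-1 ^+ n) -> series u @ \oo --> l ->
    `|l| <= 2 * B * s.
  move=> us ul; have := series_geometric_tail 0 us ul.
  by rewrite /series /= big_geq// subr0 expr0 mulr1 mulrA.
split.
  apply: tail0 cl => n; apply: (@bound n%:R); rewrite ?csize_ge0//.
    by rewrite (le_trans (natr_le_exp2 n))// lerXn2r// ?nnegrE// ler_nat.
  exact: cpow_lipschitz.
apply: (tail0 (fun n =>
    plane_scale (cpow (z + w) n - cpow z n - cmul w (dcpow z n)) (e n))).
  move=> n; apply: (@bound (n%:R ^+ 2)); rewrite ?exprn_ge0 ?csize_ge0//.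
    have -> : 4 = 2 ^+ 2 :> R by rewrite -natrX.
    by rewrite exprAC lerXn2r ?nnegrE ?exprn_ge0 ?natr_le_exp2.
  exact: cpow_taylor.
rewrite series_plane_scaleB; apply: cvgB => //.
rewrite series_plane_scaleM; apply: cvgD.
  by apply: (cvgZ (cvg_cst _)); exact: cvg_dpser.
apply: (cvgZ (cvg_cst _)); apply: (cvg_comp _ _ (cvg_dpser (z := z) ee)).
exact: imulHC_continuous.
Qed.

Lemma pser_continuous e : entire_coef e -> continuous (pser e).
Proof.
move=> ee z; have [K K0 zK] := pser_estimates z ee.
apply/cvgrPdist_le => /= eps eps0.
near=> z'.
(* The norm of R * R is the max norm, so [csize] costs a factor 2; K + 1 is used in the denominator
   since K may vanish. *)
have w1 : `|z - z'| <= Num.min 2^-1 (eps / (2 * (K + 1))).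
  near: z'; apply: (@cvgr_dist_le _ _ _ (nbhs z) _ id z cvg_id).
  by rewrite lt_min invr_gt0 ltr0n divr_gt0// mulr_gt0// ltr_wpDl.
have csize2 (w : R * R) : csize w <= 2 * `|w|.
  by rewrite prod_normE mulr_natl mulr2n lerD// le_max lexx ?orbT.
have {w1} [wh we] : csize (z' - z) <= 1 /\ K * csize (z' - z) <= eps.
  move: w1; rewrite distrC le_min => /andP[w1 w2]; split.
    by rewrite (le_trans (csize2 _))// -ler_pdivlMl// mulr1.
  move: w2; rewrite ler_pdivlMr ?mulr_gt0 ?ltr_wpDl// => w2.
  rewrite (le_trans _ w2)// [leRHS](_ : _ = (K + 1) * (2 * `|z' - z|));
    last by ring.
  by rewrite ler_pM// ?csize_ge0// lerDl.
rewrite distrC (le_trans _ we)//; have [+ _] := zK _ wh.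
by rewrite [z + _]addrC subrK.
Unshelve. all: by end_near. Qed.

Lemma quadratic_is_derive (V : normedModType R) (f : R -> V) (t K : R) (d : V) :
  (forall h, `|h| <= 1 -> `|f (t + h) - f t - h *: d| <= K * h ^+ 2) ->
  is_derive t 1 f d.
Proof.
move=> fK; have K0 : 0 <= K.
  have := fK 1; rewrite normr1 expr1n mulr1 lexx => /(_ isT).
  exact: le_trans.
suff cv : (fun h => h^-1 *: ((f \o shift t) (h *: 1) - f t)) @ 0^' --> d.
  by apply: DeriveDef; [exact: cvgP cv|exact: cvg_lim cv].
apply/cvgrPdist_le => /= eps eps0; near=> h.
have h0 : h != 0 by near: h; exact: nbhs_dnbhs_neq.
have h1 : `|h| <= Num.min 1 (eps / (K + 1)).
  near: h; apply: dnbhs0_le.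
  by rewrite lt_min ltr01 divr_gt0// ltr_wpDl.
move: h1; rewrite le_min ler_pdivlMr ?ltr_wpDl// => /andP[h1 hK].
rewrite scaler1/shift /= [h + t]addrC distrC.
rewrite -[X in _ - X](scalerK h0) -scalerBr normrZ normfV
  ler_pdivrMl ?normr_gt0//.
rewrite (le_trans (fK _ h1))// -real_normK ?num_real// expr2 mulrCA ler_wpM2l//.
by rewrite mulrC (le_trans _ hK)// ler_wpM2l// lerDl.
Unshelve. all: by end_near. Qed.

(** Increments along the two axes reduce the quadratic estimate to one variable. That the
    beta-derivative is [imulHC] of the alpha-derivative is the Cauchy-Riemann equation. *)
Lemma pser_partials e z : entire_coef e ->
  is_derive z.1 1 (fun t => pser e (t, z.2)) (pser (dcoef e) z) /\
  is_derive z.2 1 (fun t => pser e (z.1, t)) (imulHC (pser (dcoef e) z)).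
Proof.
case: z => al be ee /=; have [K K0 zK] := pser_estimates (al, be) ee.
split; apply: (@quadratic_is_derive _ _ _ K) => h h1.
- have [|_] := zK (h, 0); first by rewrite /csize /= normr0 addr0.
  rewrite /csize /= normr0 addr0 real_normK ?num_real// scale0r addr0.
  have -> : (al, be) + (h, 0) = (al + h, be) by congr pair; rewrite /= addr0.
  exact.
- have [|_] := zK (0, h); first by rewrite /csize /= normr0 add0r.
  rewrite /csize /= normr0 add0r real_normK ?num_real// scale0r add0r.
  have -> : (al, be) + (0, h) = (al, be + h) by congr pair; rewrite /= addr0.
  exact.
Qed.

End PowerSeries.

(** * Evaluation of plane series on slices *)

Section SliceFunctionsOfSeries.
Variable R : realType.
Implicit Types (e : nat -> quat R) (z : R * R) (w c : HC R) (D : set (R * R)).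
Implicit Types (x J l : quat R) (F G : R * R -> HC R).

Lemma bounded_additive_continuous (V W : normedModType R) (f : V -> W) (C : R) :
  (forall u v, f (u - v) = f u - f v) -> (forall v, `|f v| <= C * `|v|) ->
  continuous f.
Proof.
move=> fB fC v; apply/cvgrPdist_le => /= eps eps0.
near=> u; rewrite -fB (le_trans (fC _))//.
have vu : `|v - u| <= eps / (`|C| + 1).
  near: u; apply: (@cvgr_dist_le _ _ _ (nbhs v) _ id v cvg_id).
  by rewrite divr_gt0// ltr_wpDl.
move: vu; rewrite ler_pdivlMr ?ltr_wpDl// => vu.
by rewrite (le_trans _ vu)// mulrC ler_wpM2l// (le_trans (ler_norm _))// lerDl.
Unshelve. all: by end_near. Qed.

Lemma quat_mull_continuous x : continuous (fun y : quat R => x * y).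
Proof.
apply: (@bounded_additive_continuous _ _ _ `|x|) => [u v|v]; first exact: mulrBr.
by rewrite quat_normM.
Qed.

Lemma quat_mulr_continuous x : continuous (fun y : quat R => y * x).
Proof.
apply: (@bounded_additive_continuous _ _ _ `|x|) => [u v|v]; first exact: mulrBl.
by rewrite quat_normM mulrC.
Qed.

(** The real-linear substitution of J for the central imaginary unit. *)
Definition slice_eval J w : quat R := w.1 + J * w.2.

Lemma slice_evalD J : {morph slice_eval J : w1 w2 / w1 + w2}.
Proof. by move=> w1 w2; rewrite /slice_eval /= mulrDr addrACA. Qed.

Lemma slice_eval_continuous J : continuous (slice_eval J).
Proof.
move=> w; apply: cvgD; first exact: cvg_fst.
exact: (cvg_comp _ _ (@cvg_snd _ _ (nbhs w.1) (nbhs w.2) _)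
  (@quat_mull_continuous J w.2)).
Qed.

Lemma cpow_conj z n : cpow (conjC2 z) n = conjC2 (cpow z n).
Proof.
elim: n => [|n IHn] /=; first by rewrite /conjC2 /= oppr0.
by rewrite IHn; congr pair => /=; ring.
Qed.

(** Since J^2 = -1, sending alpha + i beta to alpha + J beta is a ring homomorphism from the plane
    to H. *)
Lemma slice_powE z J n : imag_unit J ->
  (z.1%:A + z.2 *: J) ^+ n = (cpow z n).1%:A + (cpow z n).2 *: J.
Proof.
rewrite /imag_unit /= expr2 => JJ; elim: n => [|n IHn].
  by rewrite expr0 /= scale1r scale0r addr0.
rewrite exprS {}IHn /=; case: (cpow z n) => p q /=.
rewrite mulrDl !mulrDr -!scalerAl -!scalerAr !mul1r mulr1 JJ !scalerA.
by rewrite scalerN !scalerDl !scaleNr [X in _ + X = _]addrC addrACA.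
Qed.

(** Conjugation commutes with the powers of z and fixes the coefficients, hence commutes with
    partial sums; continuity carries this to the limit. *)
Lemma stem_pser D e : entire_coef e -> stem D (pser e).
Proof.
move=> ee z _; apply: cvg_unique (cvg_pser ee) _; first exact: norm_hausdorff.
have -> : series (fun n => plane_scale (cpow (conjC2 z) n) (e n)) =
    (@conjHC R) \o series (fun n => plane_scale (cpow z n) (e n)).
  apply/funext => N; rewrite /series /=.
  have cD : {morph @conjHC R : x y / x + y}.
    by move=> x y; congr pair => /=; rewrite opprD.
  have c0 : conjHC 0 = 0 :> HC R by congr pair; rewrite /= oppr0.
  rewrite (big_morph _ cD c0); apply: eq_bigr => n _.
  by rewrite cpow_conj; congr pair; rewrite /= scaleNr.
apply: cvg_comp (cvg_pser ee) _.
apply: (@cvg_pair _ _ _ _ (nbhs _) (nbhs _)); first exact: cvg_fst.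
by apply: cvgN; exact: cvg_snd.
Qed.

(** Every quaternion lies on some slice, where the partial sums are the images of those of [pser e]
    under the continuous map [slice_eval J]. *)
Lemma cvg_series_slice_fun e x : entire_coef e ->
  series (fun n => x ^+ n * e n) @ \oo --> slice_fun (pser e) x.
Proof.
move=> ee; have : Omega setT x by rewrite Omega_setT.
move=> [z [J [_ JJ ->]]].
rewrite (slice_funE (D := setT))//; last exact: stem_pser.
rewrite (_ : series _ =
    slice_eval J \o series (fun n => plane_scale (cpow z n) (e n))); last first.
  apply/funext => N; rewrite /series /=.
  have J0 : slice_eval J 0 = 0 by rewrite /slice_eval mulr0 addr0.
  rewrite (big_morph (slice_eval J) (slice_evalD J) J0).
  apply: eq_bigr => n _; rewrite slice_powE// /slice_eval /=.
  by rewrite mulrDl -!scalerAl -scalerAr mul1r.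
exact: (cvg_comp _ _ (cvg_pser ee) (@slice_eval_continuous J _)).
Qed.

Definition mulrHC w l : HC R := (w.1 * l, w.2 * l).

(** Turns a coefficient recurrence into an identity of stem functions: right multiplication by l is
    continuous and commutes with the real scalars occurring in z^n. *)
Lemma pser_affine (e a b : nat -> quat R) l z :
  entire_coef e -> entire_coef a -> entire_coef b ->
  (forall n, b n = a n + e n * l) ->
  pser b z = pser a z + mulrHC (pser e z) l.
Proof.
move=> ee ae be bE; apply: cvg_unique (cvg_pser be) _; first exact: norm_hausdorff.
rewrite (_ : series _ = fun N => series (fun n => plane_scale (cpow z n) (a n)) N
    + mulrHC (series (fun n => plane_scale (cpow z n) (e n)) N) l); last first.
  apply/funext => N; rewrite /series /=.
  have mD : {morph mulrHC^~ l : x y / x + y}.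
    by move=> x y; congr pair => /=; rewrite mulrDl.
  have m0 : mulrHC 0 l = 0 by congr pair; rewrite /= mul0r.
  rewrite (big_morph _ mD m0) -big_split; apply: eq_bigr => n _.
  by rewrite bE; congr pair; rewrite /= scalerDr scalerAl.
apply: cvgD; first exact: cvg_pser.
have mc : continuous (mulrHC^~ l).
  move=> w; apply: (@cvg_pair _ _ _ _ (nbhs _) (nbhs _)).
    exact: (cvg_comp _ _ (@cvg_fst _ _ (nbhs w.1) (nbhs w.2) _)
      (@quat_mulr_continuous l w.1)).
  exact: (cvg_comp _ _ (@cvg_snd _ _ (nbhs w.1) (nbhs w.2) _)
    (@quat_mulr_continuous l w.2)).
exact: (cvg_comp _ _ (cvg_pser ee) (mc _)).
Qed.

End SliceFunctionsOfSeries.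

(** * Calculus of stem functions and local constancy *)

Section StemCalculus.
Variable R : realType.
Implicit Types (e : nat -> quat R) (z : R * R) (w c : HC R) (D : set (R * R)).
Implicit Types (x J l : quat R) (F G : R * R -> HC R) (f g : quat R -> quat R).

Lemma is_derive_linear (V W : normedModType R) (L : V -> W) (f : R -> V) (t : R)
    (d : V) :
  (forall u v, L (u - v) = L u - L v) -> (forall s v, L (s *: v) = s *: L v) ->
  continuous L -> is_derive t 1 f d -> is_derive t 1 (L \o f) (L d).
Proof.
move=> LB LZ Lc [fd <-].
have cv : (fun h => h^-1 *: (((L \o f) \o shift t) (h *: 1) - (L \o f) t)) @ 0^'
    --> L ('D_1 f t).
  rewrite (_ : (fun h => _) =
      L \o (fun h => h^-1 *: ((f \o shift t) (h *: 1) - f t))); last first.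
    by apply/funext => h /=; rewrite LZ LB.
  exact: (cvg_comp _ _ fd (Lc _)).
by apply: DeriveDef; [exact: cvgP cv|exact: cvg_lim cv].
Qed.

Lemma is_derive_reflect (V : normedModType R) (f : R -> V) (t : R) (d : V) :
  is_derive t 1 f d -> is_derive (- t) 1 (fun s => f (- s)) (- d).
Proof.
move=> [fd <-].
have cv : (fun h => h^-1 *: (((fun s => f (- s)) \o shift (- t)) (h *: 1)
    - f (- - t))) @ 0^' --> - 'D_1 f t.
  rewrite (_ : (fun h => _) =
      (fun h => - (h^-1 *: ((f \o shift t) (h *: 1) - f t))) \o -%R); last first.
    apply/funext => h /=.
    by rewrite /shift !scaler1 opprK invrN scaleNr opprK opprD opprK.
  apply: (cvg_comp _ _ _ (cvgN fd)).
  (* The substitution of -h for h respects punctured neighbourhoods of 0, being continuous and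
     injective. *)
  rewrite -[in X in _ `=>` X]oppr0; apply: continuous_injective_withinNx.
    exact: opp_continuous.
  by move=> u /oppr_inj.
by apply: DeriveDef; [exact: cvgP cv|exact: cvg_lim cv].
Qed.

Lemma near_fst (z : R * R) (P : set (R * R)) :
  nbhs z P -> \forall t \near z.1, P (t, z.2).
Proof.
move=> zP; have : (fun t : R => (t, z.2)) @ z.1 --> z.
  by apply: (@cvg_pair _ _ _ _ (nbhs _) (nbhs _)); [exact: cvg_id|exact: cvg_cst].
exact.
Qed.

Lemma near_snd (z : R * R) (P : set (R * R)) :
  nbhs z P -> \forall t \near z.2, P (z.1, t).
Proof.
move=> zP; have : (fun t : R => (z.1, t)) @ z.2 --> z.
  by apply: (@cvg_pair _ _ _ _ (nbhs _) (nbhs _)); [exact: cvg_cst|exact: cvg_id].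
exact.
Qed.

Lemma is_derive_dalpha F z w :
  is_derive z.1 1 (fun t => F (t, z.2)) w -> dalpha F z = w.
Proof. by move=> [_ <-]; rewrite /dalpha derive1E. Qed.

Lemma is_derive_dbeta F z w :
  is_derive z.2 1 (fun t => F (z.1, t)) w -> dbeta F z = w.
Proof. by move=> [_ <-]; rewrite /dbeta derive1E. Qed.

Lemma dalphaP F z : derivable (fun t => F (t, z.2)) z.1 1 ->
  is_derive z.1 1 (fun t => F (t, z.2)) (dalpha F z).
Proof. by rewrite /dalpha derive1E => Fz; exact: derivableP. Qed.

Lemma dbetaP F z : derivable (fun t => F (z.1, t)) z.2 1 ->
  is_derive z.2 1 (fun t => F (z.1, t)) (dbeta F z).
Proof. by rewrite /dbeta derive1E => Fz; exact: derivableP. Qed.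

Lemma near_eq_dz F G z : (\forall u \near z, F u = G u) -> dz F z = dz G z.
Proof.
move=> FG; rewrite /dz /dalpha /dbeta !derive1E.
by rewrite (@near_eq_derive R R (HC R) _ _ z.1 1 (near_fst FG))
  (@near_eq_derive R R (HC R) _ _ z.2 1 (near_snd FG)).
Qed.

Lemma conjHC_is_derive (f : R -> HC R) (t : R) w :
  is_derive t 1 f w -> is_derive t 1 (fun s => conjHC (f s)) (conjHC w).
Proof.
apply: is_derive_linear.
- by move=> u v; congr pair; rewrite /= opprB opprK addrC.
- by move=> s v; congr pair; rewrite /= scalerN.
- move=> u; apply: (@cvg_pair _ _ _ _ (nbhs _) (nbhs _)); first exact: cvg_fst.
  by apply: cvgN; exact: cvg_snd.
Qed.

(* Needed because [slice_fun] only sees a function on the upper half plane;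
   vanishing of a slice function passes to the whole domain for stem functions. *)
Lemma stem_dz D F : symmetric_open D -> stem D F -> C1_on D F -> stem D (dz F).
Proof.
move=> [oD sD] sF F1 z Dz; have [Fa Fb _ _] := F1 z Dz.
have nD : nbhs (conjC2 z) D by exact: open_nbhs_nbhs (conj oD (sD _ Dz)).
have Fconj : \forall u \near conjC2 z, conjHC (F (conjC2 u)) = F u.
  apply: filterS nD => u Du; rewrite sF//.
  by case: (F u) => p q; rewrite /conjHC /= opprK.
have da : dalpha F (conjC2 z) = conjHC (dalpha F z).
  apply: is_derive_dalpha; apply: (near_eq_is_derive (near_fst Fconj)).
  rewrite [X in is_derive _ _ X _](_ : _ = fun t => conjHC (F (t, z.2))).
    exact: conjHC_is_derive (dalphaP Fa).
  by apply/funext => t; rewrite /conjC2 /= opprK.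
have db : dbeta F (conjC2 z) = - conjHC (dbeta F z).
  apply: is_derive_dbeta; apply: (near_eq_is_derive (near_snd Fconj)).
  exact: is_derive_reflect (conjHC_is_derive (dbetaP Fb)).
rewrite /dz da db; congr pair => /=; first by rewrite opprK.
by rewrite -scalerN opprB opprK addrC.
Qed.

(** When x = alpha + J beta with beta < 0, one has |Im x| = -beta, and the symmetry of D supplies
    the conjugate point. *)
Lemma slice_point D x : (forall z, D z -> D (conjC2 z)) -> Omega D x ->
  D (q0 x, `|qim x|).
Proof.
move=> sD [z [J [Dz /imag_unitP[J0 J1] ->]]].
have -> : q0 (z.1%:A + z.2 *: J) = z.1 by rewrite /= J0; ring.
have -> : qim (z.1%:A + z.2 *: J) = z.2 *: J.
  by apply: eq_quat => /=; rewrite ?J0; ring.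
rewrite normrZ J1 mulr1; case: (ger0P z.2) => _; last exact: sD.
by rewrite -surjective_pairing.
Qed.

(** [stem_of D f] and F are known to agree only on D; as D is open they agree near the point, which
    suffices for partial derivatives. *)
Lemma slice_derivE D F f x : symmetric_open D -> induces D F f -> Omega D x ->
  slice_deriv D f x = slice_fun (dz F) x.
Proof.
move=> [oD sD] Ff Dx; have Dz := slice_point sD Dx.
rewrite /slice_deriv /slice_fun (@near_eq_dz _ F)//.
have : nbhs (q0 x, `|qim x|) D by exact: open_nbhs_nbhs.
by apply: filterS => u Du; exact: stem_ofE.
Qed.

(** F and the zero stem function induce the same slice function, so uniqueness of the stem function
    applies. *)
Lemma slice_fun_inj D F : (forall z, D z -> D (conjC2 z)) -> stem D F ->
  (forall x, Omega D x -> slice_fun F x = 0) -> forall z, D z -> F z = 0.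
Proof.
move=> sD sF F0 z Dz.
have iF : induces D F (fun=> 0) by split=> // x Dx; rewrite F0.
have i0 : induces D (fun=> 0) (fun=> 0).
  split=> [u _|x _]; first by congr pair; rewrite /= oppr0.
  by rewrite /slice_fun mulr0 addr0.
by rewrite -(stem_ofE sD iF Dz) (stem_ofE sD i0 Dz).
Qed.

Lemma real_is_derive0_cst (f : R -> R) (t r : R) :
  (forall s, `|t - s| < r -> is_derive s 1 f 0) ->
  forall s, `|t - s| < r -> f s = f t.
Proof.
move=> f0; have cst a b : a <= b -> (forall s, a <= s <= b -> `|t - s| < r) ->
    f a = f b.
  move=> ab abr.
  have d0 s : a <= s <= b -> is_derive s 1 f 0 by move=> /abr/f0.
  have [||c _] := @MVT_segment R f (fun=> 0) a b ab.
  - by move=> s /itvP sab; apply: d0; rewrite !sab.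
  - apply: derivable_within_continuous => s; rewrite in_itv => /d0 fs.
    exact: ex_derive.
  - by rewrite mul0r => /eqP; rewrite subr_eq0 => /eqP.
move=> s sr; have [st|ts] := leP s t.
  apply: cst => // u /andP[su ut]; apply: le_lt_trans sr.
  by rewrite !ger0_norm ?subr_ge0// lerB.
apply/esym/cst => [|u /andP[tu us]]; first exact: ltW.
apply: le_lt_trans sr; rewrite !(distrC t) !ger0_norm ?subr_ge0 ?(ltW ts)//.
by rewrite lerD2r.
Qed.

Lemma HC_is_derive0_cst (f : R -> HC R) (t r : R) :
  (forall s, `|t - s| < r -> is_derive s 1 f 0) ->
  forall s, `|t - s| < r -> f s = f t.
Proof.
move=> f0 s sr.
have quat_cst (k : R -> quat R) : (forall s, `|t - s| < r -> is_derive s 1 k 0) ->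
    k s = k t.
  move=> k0.
  have coord (q : quat R -> R) : (forall u v, q (u - v) = q u - q v) ->
      (forall a v, q (a *: v) = a * q v) -> (forall v, `|q v| <= `|v|) ->
      q (k s) = q (k t).
    move=> qB qZ qn.
    apply: (@real_is_derive0_cst (q \o k) t r) sr => u ur.
    have q00 : q 0 = 0 by rewrite -(subrr 0) qB subrr.
    rewrite -[X in is_derive _ _ _ X]q00.
    apply: is_derive_linear => //; last exact: k0.
    by apply: (@bounded_additive_continuous _ _ _ _ 1) => // v; rewrite mul1r.
  by apply: eq_quat; apply: coord => // v; case: (coord_le_norm v).
rewrite [LHS]surjective_pairing [RHS]surjective_pairing; congr pair.
  apply: (quat_cst (fst \o f)) => u ur.
  by apply: (is_derive_linear (L := fst) (d := 0)) => //;
    [move=> ?; exact: cvg_fst|exact: f0].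
apply: (quat_cst (snd \o f)) => u ur.
by apply: (is_derive_linear (L := snd) (d := 0)) => //;
  [move=> ?; exact: cvg_snd|exact: f0].
Qed.

Lemma slice_constant_locally D G g z : symmetric_open D -> induces D G g ->
  C1_on D G -> (forall z, D z -> dzbar G z = 0) ->
  (forall x, Omega D x -> slice_deriv D g x = 0) -> D z ->
  \forall u \near z, G u = G z.
Proof.
move=> sD Gg G1 Gbar g0 Dz.
have dG u : D u -> dz G u = 0.
  apply: slice_fun_inj; first by case: sD.
    by apply: stem_dz => //; case: Gg.
  by move=> x Dx; rewrite -(slice_derivE sD Gg Dx) g0.
(* The sum and the difference of [dalpha G u] and [imulHC (dbeta G u)] vanish, hence so does
   each. *)
have dab u : D u -> dalpha G u = 0 /\ dbeta G u = 0.
  move=> Du; have := dG _ Du; have := Gbar _ Du; rewrite /dzbar /dz.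
  move=> /eqP; rewrite scaler_eq0 invr_eq0 pnatr_eq0/= => /eqP e1.
  move=> /eqP; rewrite scaler_eq0 invr_eq0 pnatr_eq0/= subr_eq0 => /eqP e2.
  have i0 : imulHC (dbeta G u) = 0.
    move: e1; rewrite e2 -mulr2n -scaler_nat => /eqP.
    by rewrite scaler_eq0 pnatr_eq0/= => /eqP.
  split; first by rewrite e2.
  have /eqP := congr1 fst i0; rewrite /= oppr_eq0 => /eqP b2.
  by rewrite [LHS]surjective_pairing b2 (congr1 snd i0 : (dbeta G u).1 = 0).
have /nbhs_ballP[r /= r0 zr] : nbhs z D.
  by apply: open_nbhs_nbhs; split=> //; case: sD.
apply/nbhs_ballP; exists r => // u [ur1 ur2].
(* Balls of R * R are squares, so the horizontal segment from u to [(z.1, u.2)] and the vertical one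
   from there to z stay in D. *)
have rD a b : `|z.1 - a| < r -> `|z.2 - b| < r -> D (a, b).
  by move=> h1 h2; apply: zr; split.
rewrite [u]surjective_pairing [z]surjective_pairing.
apply: (@eq_trans _ _ (G (z.1, u.2))).
  apply: (@HC_is_derive0_cst (fun t => G (t, u.2)) z.1 r) => // s sr.
  have Ds := rD _ _ sr ur2; have [Ga _ _ _] := G1 _ Ds.
  by have [<- _] := dab _ Ds; exact: dalphaP Ga.
apply: (@HC_is_derive0_cst (fun t => G (z.1, t)) z.2 r) => // s sr.
have Ds : D (z.1, s) by apply: rD => //; rewrite subrr normr0.
have [_ Gb _ _] := G1 _ Ds.
by have [_ <-] := dab _ Ds; exact: dbetaP Gb.
Qed.

End StemCalculus.

(** * Left multiplication in H (x) C, and growth of the coefficients of E_lambda(h) *)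

Section ProductsAndCoefficients.
Variable R : realType.
Implicit Types (e a : nat -> quat R) (z : R * R) (w c : HC R).
Implicit Types (D : set (R * R)) (x J lambda : quat R) (F G : R * R -> HC R).

Lemma mulHC_continuous c : continuous (mulHC c).
Proof.
move=> w.
have c1 x : (fun w : HC R => x * w.1) @ w --> x * w.1.
  exact: (cvg_comp _ _ (@cvg_fst _ _ (nbhs w.1) (nbhs w.2) _)
    (@quat_mull_continuous _ x w.1)).
have c2 x : (fun w : HC R => x * w.2) @ w --> x * w.2.
  exact: (cvg_comp _ _ (@cvg_snd _ _ (nbhs w.1) (nbhs w.2) _)
    (@quat_mull_continuous _ x w.2)).
apply: (@cvg_pair _ _ _ _ (nbhs _) (nbhs _)); first exact: cvgB.
exact: cvgD.
Qed.

Lemma mulHCB c w1 w2 : mulHC c (w1 - w2) = mulHC c w1 - mulHC c w2.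
Proof.
congr pair; rewrite /= !mulrBr; last by rewrite opprD addrACA.
by rewrite !opprB addrACA [RHS]addrACA; congr +%R; exact: addrC.
Qed.

Lemma mulHCD c w1 w2 : mulHC c (w1 + w2) = mulHC c w1 + mulHC c w2.
Proof.
by congr pair; rewrite /= !mulrDr ?opprD addrACA.
Qed.

Lemma mulHCZ c (s : R) w : mulHC c (s *: w) = s *: mulHC c w.
Proof. by congr pair; rewrite /= -!scalerAr ?scalerBr ?scalerDr. Qed.

Lemma mulHC_imul c w : mulHC c (imulHC w) = imulHC (mulHC c w).
Proof. by congr pair; rewrite /= mulrN ?opprD// addrC. Qed.

Lemma mulHC_mulr c w l : mulHC c (mulrHC w l) = mulrHC (mulHC c w) l.
Proof. by congr pair; rewrite /= !mulrA ?mulrBl ?mulrDl. Qed.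

Lemma conjHC_mul w1 w2 : conjHC (mulHC w1 w2) = mulHC (conjHC w1) (conjHC w2).
Proof.
by congr pair; rewrite /= ?mulrNN// opprD mulrN mulNr.
Qed.

Lemma imulHCK w : imulHC (imulHC w) = - w. Proof. by []. Qed.

(** Left multiplication by c is real-linear and commutes with [imulHC], so the Cauchy-Riemann
    equation survives. Equality is assumed only near z because the factor c may vary between
    components: D can be disconnected while [Omega D] is connected. *)
Lemma locally_const_mul_pser F e c z : entire_coef e ->
  (\forall u \near z, F u = mulHC c (pser e u)) ->
  [/\ [/\ derivable (fun t => F (t, z.2)) z.1 1,
          derivable (fun t => F (z.1, t)) z.2 1,
          {for z, continuous (dalpha F)} & {for z, continuous (dbeta F)}],
      dz F z = mulHC c (pser (dcoef e) z) & dzbar F z = 0].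
Proof.
move=> ee Fc.
have local u : (\forall v \near u, F v = mulHC c (pser e v)) ->
    is_derive u.1 1 (fun t => F (t, u.2)) (mulHC c (pser (dcoef e) u)) /\
    is_derive u.2 1 (fun t => F (u.1, t)) (mulHC c (imulHC (pser (dcoef e) u))).
  move=> Fu; have [da db] := pser_partials u ee.
  have mulc := fun (f : R -> HC R) (t : R) (d : HC R) =>
    @is_derive_linear R _ _ (mulHC c) f t d (mulHCB c) (mulHCZ c)
      (@mulHC_continuous c).
  split.
    have Fu1 := near_fst Fu.
    apply: near_eq_is_derive (mulc _ _ _ da).
    by apply: filterS Fu1 => t; exact: esym.
  have Fu2 := near_snd Fu.
  apply: near_eq_is_derive (mulc _ _ _ db).
  by apply: filterS Fu2 => t; exact: esym.
have [Fa Fb] := local z Fc.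
have cd := pser_continuous (entire_dcoef ee).
have cm (f : R * R -> HC R) : {for z, continuous f} ->
    {for z, continuous (fun u => mulHC c (f u))}.
  by move=> cf; exact: (cvg_comp _ _ cf (@mulHC_continuous c _)).
split; last 2 first.
- rewrite /dz (is_derive_dalpha Fa) (is_derive_dbeta Fb) mulHC_imul imulHCK.
  by rewrite opprK -mulr2n -[mulHC c _ *+ 2]scaler_nat scalerA mulVf ?pnatr_eq0//
    scale1r.
- by rewrite /dzbar (is_derive_dalpha Fa) (is_derive_dbeta Fb) mulHC_imul imulHCK
    subrr scaler0.
split; [by case: Fa|by case: Fb| |].
- rewrite /prop_for /continuous_at (is_derive_dalpha Fa).
  apply: cvg_trans (cm _ (cd z)); apply: near_eq_cvg.
  (* Continuity at z involves the partial derivatives at nearby points u, so the equality must hold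
     around each such u. *)
  apply: filterS (near_join Fc) => u Fu.
  exact/esym/is_derive_dalpha/(local u Fu).1.
- rewrite /prop_for /continuous_at (is_derive_dbeta Fb).
  have ci : {for z, continuous (fun u => imulHC (pser (dcoef e) u))}.
    exact: (cvg_comp _ _ (cd z) (@imulHC_continuous _ _)).
  apply: cvg_trans (cm _ ci); apply: near_eq_cvg.
  apply: filterS (near_join Fc) => u Fu.
  exact/esym/is_derive_dbeta/(local u Fu).2.
Qed.

Definition Elam_coef lambda a n : quat R :=
  n`!%:R^-1 *: \sum_(0 <= k < n) (k`!%:R *: a k) * lambda ^+ (n - k - 1).

Lemma Elam_coef0 lambda a : Elam_coef lambda a 0 = 0.
Proof. by rewrite /Elam_coef big_geq// scaler0. Qed.

(** [series] excludes its upper index while the sum includes n = N, whence [N.+1]; the added term n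
    = 0 vanishes. *)
Lemma Elam_psumE lambda a N x :
  Elam_psum lambda a N x = series (fun n => x ^+ n * Elam_coef lambda a n) N.+1.
Proof.
rewrite /series /= big_ltn// Elam_coef0 mulr0 add0r.
by apply: eq_bigr => n _; rewrite -scalerAl scalerAr.
Qed.

(** The last term k = n of the inner sum yields a_n; every other term carries one more factor lambda
    than in e_n. *)
Lemma dcoef_Elam_coef lambda a n :
  dcoef (Elam_coef lambda a) n = a n + Elam_coef lambda a n * lambda.
Proof.
rewrite /dcoef /Elam_coef scalerA factS natrM invfM mulrA divff ?pnatr_eq0//.
rewrite mul1r big_nat_recr//= subSnn subnn expr0 mulr1 scalerDr addrC scalerA.
rewrite mulVf ?pnatr_eq0 -?lt0n ?fact_gt0// scale1r; congr +%R.
rewrite -scalerAl mulr_suml; congr *:%R; apply: eq_big_nat => k /andP[_ kn].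
by rewrite -[RHS]mulrA -exprSr; congr (_ * _ ^+ _); lia.
Qed.

(** At the real quaternion r the terms of the convergent series tend to 0, hence are bounded. *)
Lemma entire_coef_cvg a :
  (forall x, cvgn (series (fun n => x ^+ n * a n))) -> entire_coef a.
Proof.
move=> ca r r0; have /cvg_series_cvg_0/cvgP/cvg_seq_bounded := ca r%:A.
move=> [B [_ aB]]; exists (B + 1) => n.
have /(_ n I) := aB (B + 1) (ltr_pwDr ltr01 (lexx _)).
by rewrite /= quat_normM quat_normX normrZ quat_normr1 mulr1 ger0_norm// mulrC.
Qed.

Lemma exp_term_bounded (s : R) n : 0 <= s -> s ^+ n / n`!%:R <= expR s.
Proof.
move=> s0; case: n => [|n]; first by rewrite expr0 fact0 divr1 -expR0 ler_expR.
by apply: le_trans (expR_ge1Dxn n s0); rewrite lerDr.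
Qed.

(** With lambda = 0 the recurrence reads (n+1) e_(n+1) = a_n, so the bound on a carries over up to a
    factor r. *)
Lemma entire_Elam_coef0 a : entire_coef a -> entire_coef (Elam_coef 0 a).
Proof.
move=> ea r r0; have [B aB] := ea r r0.
have B0 : 0 <= B by have := aB 0; rewrite expr0 mulr1; exact: le_trans.
exists (B * r) => -[|n].
  by rewrite Elam_coef0 normr0 mul0r mulr_ge0.
have -> : Elam_coef 0 a n.+1 = n.+1%:R^-1 *: a n.
  rewrite -[a n]addr0 -[0 in RHS](mulr0 (Elam_coef 0 a n)) -dcoef_Elam_coef.
  by rewrite /dcoef scalerA mulVf ?pnatr_eq0// scale1r.
rewrite normrZ exprSr mulrA ler_wpM2r// (le_trans _ (aB n))//.
rewrite ler_wpM2r ?exprn_ge0//.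
by rewrite ler_piMl// ger0_norm ?invr_ge0// invf_le1 ?ler1n ?ltr0n.
Qed.

Lemma entire_Elam_coef lambda a (C : R) (d : nat) : 0 <= C ->
  (forall n, n`!%:R * `|a n| <= C * n.+1%:R ^+ d * `|lambda| ^+ n) ->
  entire_coef (Elam_coef lambda a).
Proof.
(* In s, the factor 2 accounts for the n <= 2^n inner terms, 2^d for (k+1)^d <= (2^d)^n, and
   |lambda| + 1 for the powers of |lambda|. Then |e_n| r^n <= C s^n / n! <= C exp(s). *)
move=> C0 aC r r0; pose s := 2 * 2 ^+ d * (`|lambda| + 1) * r.
exists (C * expR s) => n.
have s0 : 0 <= s by rewrite !mulr_ge0 ?exprn_ge0 ?addr_ge0.
have sumB : `|\sum_(0 <= k < n) (k`!%:R *: a k) * lambda ^+ (n - k - 1)| <=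
    n%:R * (C * (2 ^+ d * (`|lambda| + 1)) ^+ n).
  apply: (le_trans (ler_norm_sum _ _ _)).
  rewrite -[n in n%:R * _]subn0 mulr_natl -sumr_const_nat.
  rewrite big_nat_cond [leRHS]big_nat_cond; apply: ler_sum => k.
  rewrite andbT => /andP[_ kn].
  rewrite quat_normM quat_normX normrZ normr_nat.
  rewrite (le_trans (ler_wpM2r _ (aC k))) ?exprn_ge0//.
  rewrite -!mulrA -exprD ler_wpM2l// exprMn ler_pM ?exprn_ge0//.
    rewrite exprAC lerXn2r ?nnegrE ?exprn_ge0//.
    by rewrite (le_trans _ (natr_le_exp2 _ n))// ler_nat.
  (* The total exponent is n - 1; the base |lambda| + 1 >= 1 lets it rise to n. *)
  rewrite (@le_trans _ _ ((`|lambda| + 1) ^+ (k + (n - k - 1))))//.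
    by rewrite lerXn2r ?nnegrE ?addr_ge0// lerDl.
  by rewrite ler_weXn2l ?lerDr//; lia.
rewrite /Elam_coef normrZ ger0_norm ?invr_ge0//.
rewrite (@le_trans _ _ (C * (s ^+ n / n`!%:R)))//; last first.
  by rewrite ler_wpM2l// exp_term_bounded.
rewrite [leRHS](_ : _ = n`!%:R^-1 *
    (2 ^+ n * (C * (2 ^+ d * (`|lambda| + 1)) ^+ n)) * r ^+ n); last first.
  by rewrite /s !exprMn; ring.
rewrite ler_wpM2r ?exprn_ge0// ler_wpM2l ?invr_ge0// (le_trans sumB)//.
by rewrite ler_wpM2r ?natr_le_exp2// mulr_ge0// exprn_ge0 ?mulr_ge0
   ?exprn_ge0 ?addr_ge0.
Qed.

End ProductsAndCoefficients.

(** * Slice-regularity of entire series and their products with slice-constant functions *)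

Section MainArgument.
Variable R : realType.
Implicit Types (e a b : nat -> quat R) (D : set (R * R)) (x l : quat R).

Lemma induces_pser D e f : entire_coef e ->
  (forall x, f x = slice_fun (pser e) x) -> induces D (pser e) f.
Proof. by move=> ee fE; split=> [|x _]; [exact: stem_pser|exact: fE]. Qed.

Lemma slice_fun_pser_regular e : entire_coef e ->
  slice_regular setT (slice_fun (pser e)).
Proof.
move=> ee; exists (pser e).
have loc (z : R * R) : \forall u \near z, pser e u = mulHC (1, 0) (pser e u).
  by near=> u; rewrite /mulHC /= !mul1r !mul0r subr0 addr0.
split; first exact: induces_pser.
- by move=> z _; have [] := locally_const_mul_pser ee (loc z).
- by move=> z _; have [] := locally_const_mul_pser ee (loc z).
Unshelve. all: by end_near. Qed.

Lemma dz_pser e z : entire_coef e -> dz (pser e) z = pser (dcoef e) z.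
Proof.
move=> ee; have [da db] := pser_partials z ee.
rewrite /dz (is_derive_dalpha da) (is_derive_dbeta db) imulHCK opprK -mulr2n.
by rewrite -[pser _ _ *+ 2]scaler_nat scalerA mulVf ?pnatr_eq0// scale1r.
Qed.

(** The direction of x acts on the left and l on the right, so by associativity the relation passes
    from stem functions to slice functions. *)
Lemma slice_fun_mulr (F G H : R * R -> HC R) l x :
  F (q0 x, `|qim x|) = H (q0 x, `|qim x|) + mulrHC (G (q0 x, `|qim x|)) l ->
  slice_fun F x - slice_fun G x * l = slice_fun H x.
Proof.
rewrite /slice_fun => -> /=; apply/eqP; rewrite subr_eq; apply/eqP.
by rewrite mulrDr mulrDl addrACA mulrA.
Qed.

(** Near each point of D the stem function of g is constant, so the derivative falls on the series
    alone. *)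
Lemma slice_mul_pser D g e : symmetric_open D -> slice_constant D g ->
  entire_coef e ->
  let F := fun z => mulHC (stem_of D g z) (pser e z) in
  [/\ stem D F, C1_on D F
    & forall z, D z -> dz F z = mulHC (stem_of D g z) (pser (dcoef e) z)].
Proof.
move=> sDo [[G [Gg G1 Gbar]] g0] ee F; have [oD sD] := sDo.
have gG z : D z -> stem_of D g z = G z by move=> Dz; exact: stem_ofE.
have loc z : D z -> \forall u \near z, F u = mulHC (stem_of D g z) (pser e u).
  move=> Dz; have Gz := slice_constant_locally sDo Gg G1 Gbar g0 Dz.
  have Du : nbhs z D by exact: open_nbhs_nbhs.
  by apply: filterS2 Gz Du => u Gu Du; rewrite /F !gG// Gu.
split=> z Dz.
- by rewrite /F !gG ?(stem_pser ee Dz) ?conjHC_mul//; [case: Gg => -> | exact: sD].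
- by have [] := locally_const_mul_pser ee (loc z Dz).
- by have [] := locally_const_mul_pser ee (loc z Dz).
Qed.

End MainArgument.

(** * Convergence, regularity and differential equations for E_lambda(h) *)

Theorem proposition18 (R : realType) (lambda : quat R) (a : nat -> quat R)
    (h : quat R -> quat R)
    (h_sum : forall x : quat R, series (fun n => x ^+ n * a n) @ \oo --> h x)
    (h_regular : slice_regular setT h)
    (h_growth : lambda != 0 ->
      exists C : R, 0 < C /\ exists d : nat, forall n : nat,
        n`!%:R * `|a n| <= C * n.+1%:R ^+ d * `|lambda| ^+ n) :
  [/\ {family compact, Elam_psum lambda a @ \oo --> Elam lambda a},
      slice_regular setT (Elam lambda a),
      forall x : quat R, Dlam setT lambda (Elam lambda a) x = h x
    & forall (D : set (R * R)) (g : quat R -> quat R),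
        axially_symmetric_domain D -> slice_constant D g ->
        slice_C1 D (slice_mul D g (Elam lambda a)) /\
        forall x : quat R, Omega D x ->
          Dlam D lambda (slice_mul D g (Elam lambda a)) x
          = slice_mul D g h x].
Proof.
have ea : entire_coef a by apply: entire_coef_cvg => x; exact: cvgP (h_sum x).
set e := Elam_coef lambda a.
have ee : entire_coef e.
  rewrite /e; have [->|/h_growth[C [C0 [d aC]]]] := eqVneq lambda 0.
    exact: entire_Elam_coef0.
  exact: entire_Elam_coef (ltW C0) aC.
have hE x : h x = slice_fun (pser a) x.
  apply: cvg_unique (h_sum x) _; first exact: norm_hausdorff.
  exact: cvg_series_slice_fun.
have Ecvg x : Elam_psum lambda a ^~ x @ \oo --> slice_fun (pser e) x.
  rewrite (_ : Elam_psum lambda a ^~ x =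
    fun N => series (fun n => x ^+ n * e n) N.+1); last first.
    by apply/funext => N; exact: Elam_psumE.
  rewrite (cvg_shiftS (series _)); exact: cvg_series_slice_fun.
have EE : Elam lambda a = slice_fun (pser e).
  by apply/funext => x; exact: cvg_lim (Ecvg x).
(* The coefficient recurrence, summed: this is D_lambda(E_lambda(h)) = h on stem functions. *)
have recur z : pser (dcoef e) z = pser a z + mulrHC (pser e z) lambda.
  apply: pser_affine => //; first exact: entire_dcoef.
  exact: dcoef_Elam_coef.
have stemE D z : (forall z, D z -> D (conjC2 z)) -> D z ->
    stem_of D (slice_fun (pser e)) z = pser e z.
  by move=> sD Dz; apply: stem_ofE => //; exact: induces_pser.
rewrite EE; split.
- apply/fam_cvgP => A /compact_bounded[M [_ AM]] P /uniform_nbhs[U [entU UP]].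
  have [eps eps0 epsU] : exists2 eps : R, 0 < eps &
      forall u v : quat R, `|u - v| < eps -> U (u, v).
    move: entU; rewrite -entourage_ballE => -[eps /= eps0 epsU].
    by exists eps => // u v uv; apply: epsU; rewrite /= -ball_normE.
  (* Every number above M bounds A, hence M + 1; the absolute value makes it a radius whatever its
     sign. The same B serves all x in A, so the tail bound is uniform. *)
  have [B B0 eB] := entire_coef_half ee (normr_ge0 (M + 1)).
  have tail x N : A x ->
      `|slice_fun (pser e) x - Elam_psum lambda a N x| <= 2 * B * 2^-1 ^+ N.+1.
    move=> Ax; rewrite Elam_psumE; apply: series_geometric_tail => [n|].
      rewrite quat_normM quat_normX mulrC (le_trans _ (eB n))// ler_wpM2l//.
      rewrite lerXn2r ?nnegrE// (le_trans _ (ler_norm _))//.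
      exact: AM (ltr_pwDr ltr01 (lexx _)) _ Ax.
    exact: cvg_series_slice_fun.
  have half1 : `|2^-1 : R| < 1 by rewrite ger0_norm ?invr_ge0// invf_lt1 ?ltr1n.
  have := @cvgr_dist_lt _ _ _ _ _ _ _ (@cvg_geometric _ (2 * B) _ half1) _ eps0.
  move=> [N0 _ N0eps]; exists N0 => // N /N0eps; rewrite /= sub0r normrN => NB.
  apply: UP => x Ax; apply: epsU; apply: le_lt_trans (tail x N Ax) _.
  apply: le_lt_trans NB; rewrite ger0_norm ?mulr_ge0 ?exprn_ge0 ?invr_ge0//.
  rewrite ler_wpM2l ?mulr_ge0// exprS ler_piMl ?exprn_ge0 ?invr_ge0//.
  by rewrite ltW// -[2^-1]ger0_norm ?invr_ge0.
- exact: slice_fun_pser_regular.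
- move=> x; have Tx : Omega setT x by rewrite Omega_setT.
  have sT : symmetric_open [set: R * R] by split=> //; exact: openT.
  rewrite /Dlam (slice_derivE sT (induces_pser _ ee (fun=> erefl)) Tx) hE.
  by apply: slice_fun_mulr; rewrite dz_pser.
- move=> D g [sDo _ _] gD; have [oD sD] := sDo.
  set F := fun z => mulHC (stem_of D g z) (pser e z).
  have [sF F1 dF] := slice_mul_pser sDo gD ee.
  have mulE x : Omega D x ->
      slice_mul D g (slice_fun (pser e)) x = slice_fun F x.
    move=> Dx; have Dz := slice_point sD Dx.
    by rewrite /slice_mul /slice_fun stemE.
  have iF : induces D F (slice_mul D g (slice_fun (pser e))) by split.
  split; first by exists F.
  move=> x Dx; have Dz := slice_point sD Dx.
  rewrite /Dlam (slice_derivE sDo iF Dx) mulE//.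
  (* By [recur], the derivative of F is the stem function of g times the series of a, plus F
     multiplied on the right by lambda. *)
  apply: slice_fun_mulr; rewrite dF// recur mulHCD mulHC_mulr; congr (mulHC _ _ + _).
  by apply/esym/stem_ofE => //; exact: induces_pser.
Qed.
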